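(* Let $\alpha,\beta\ge 0$ be integers and let $Z_{\alpha,\beta}$ be the graph consisting of a centre vertex $v$ together with $2\beta+1$ paths, each having $\alpha+1$ vertices other than $v$, attached at $v$ (pairwise disjoint except at $v$), so that $Z_{\alpha,\beta}$ has $n=1+(2\beta+1)(\alpha+1)$ vertices. Then for $n$ robots, there is no way to add at most $\alpha$ new vertices and at most $\beta$ new edges (each new edge joining two vertices of $Z_{\alpha,\beta}$, a vertex of $Z_{\alpha,\beta}$ and a new vertex, or two new vertices) so that the resulting graph is universally solvable for $n$ robots.
   Context: Robots are $R=[p]$; a configuration on a graph $H=(W,F)$ is an injective map $S:R\to W$. A pair $(S,S')$ of configurations is a valid move if it is one of: (i) a simple path move: there is a simple path $(u_0,\dots,u_k)$ in $H$ with $u_k\notin S(R)$, $u_0\notin S'(R)$, $S'(i)=S(i)$ for robots not on the path, and $S'(i)=u_{j+1}$ whenever $S(i)=u_j$, $0\le j\le k-1$; (ii) a simple rotation move: there is a simple cycle $(u_0,\dots,u_{k-1},u_k=u_0)$ in $H$ all of whose vertices are occupied in $S$ and in $S'$, robots off the cycle stay fixed, and $S'(i)=u_{j+1}$ whenever $S(i)=u_j$; (iii) a dummy move $(S,S)$. $T$ is reachable from $S$ if there is a finite sequence $S=S_0,\dots,S_t=T$ with each $(S_{k-1},S_k)$ a valid move. $H$ is universally solvable for $p$ robots if every configuration is reachable from every other. *)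

(* Defs.v *)
From HB Require Import structures.
From mathcomp Require Import all_boot.

Set Implicit Arguments.
Unset Strict Implicit.
Unset Printing Implicit Defensive.

Record sgraph (W : finType) := SGraph {
  adj :> rel W;
  adj_sym : symmetric adj;
  adj_irr : irreflexive adj
}.

Definition edges (W : finType) (H : sgraph W) : {set {set W}} :=
  [set [set u.1; u.2] | u : W * W & H u.1 u.2].

Record configuration (p : nat) (W : finType) := Configuration {
  position :> {ffun 'I_p -> W};
  position_inj : injectiveb position
}.

HB.instance Definition _ p W := [isSub for @position p W].
HB.instance Definition _ p W := [Finite of configuration p W by <:].

Section Moves.

Variables (p : nat) (W : finType) (H : sgraph W).
Implicit Types S T : configuration p W.

(* The path (u_0, ..., u_k) is u0 :: s, with k = size s and u_k = last u0 s. *)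
Definition simple_path_move S T : Prop :=
  exists (u0 : W) (s : seq W),
    [/\ path H u0 s && uniq (u0 :: s),
        last u0 s \notin codom S,
        u0 \notin codom T,
        forall i, S i \notin u0 :: s -> T i = S i
      & forall i j, j < size s ->
          S i = nth u0 (u0 :: s) j -> T i = nth u0 (u0 :: s) j.+1].

(* The cycle (u_0, ..., u_{k-1}, u_k = u_0) is c = [:: u_0; ...; u_{k-1}].
   A simple cycle of a simple graph has k >= 3, so the two robots at the ends
   of an edge cannot be swapped by a rotation. *)
Definition simple_rotation_move S T : Prop :=
  exists c : seq W,
    [/\ [&& 3 <= size c, cycle H c & uniq c],
        {subset c <= codom S},
        {subset c <= codom T},
        forall i, S i \notin c -> T i = S i
      & forall i, S i \in c -> T i = next c (S i)].

Definition valid_move S T : Prop :=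
  [\/ simple_path_move S T, simple_rotation_move S T | T = S].

Definition reachable S T : Prop :=
  exists (t : nat) (C : nat -> configuration p W),
    [/\ C 0 = S, C t = T & forall k, k < t -> valid_move (C k) (C k.+1)].

End Moves.

Definition universally_solvable (p : nat) (W : finType) (H : sgraph W) : Prop :=
  forall S T : configuration p W, reachable H S T.

(* In the next two definitions the vertices of H are those of G (inl) together
   with the new ones (inr). *)
Definition extends (V N : finType) (G : sgraph V) (H : sgraph (V + N)%type) :
    Prop :=
  forall x y : V, G x y -> H (inl x) (inl y).

Definition new_edges (V N : finType) (G : sgraph V)
    (H : sgraph (V + N)%type) : {set {set V + N}} :=
  edges H :\: [set [set inl x | x in E] | E : {set V} in edges G].

(* None is the centre v, and Some (i, j) is the vertex at distance j + 1 from v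
   on the i-th path. *)
Definition Zvertex (alpha beta : nat) : finType :=
  option ('I_(2 * beta + 1) * 'I_(alpha + 1)).

Definition Zadj (alpha beta : nat) (x y : Zvertex alpha beta) : bool :=
  match x, y with
  | None, None => false
  | None, Some (_, j) | Some (_, j), None => j == 0 :> nat
  | Some (i, j), Some (i', j') =>
      (i == i') && ((j' == j.+1 :> nat) || (j == j'.+1 :> nat))
  end.

Lemma Zadj_sym alpha beta : symmetric (@Zadj alpha beta).
Proof. by move=> [[i j]|] [[i' j']|] //=; rewrite eq_sym orbC. Qed.

Lemma Zadj_irr alpha beta : irreflexive (@Zadj alpha beta).
Proof. by move=> [[i j]|] //=; rewrite orbb ltn_eqF ?andbF. Qed.

Definition Zgraph (alpha beta : nat) : sgraph (Zvertex alpha beta) :=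
  SGraph (@Zadj_sym alpha beta) (@Zadj_irr alpha beta).

Lemma card_Zvertex alpha beta :
  #|Zvertex alpha beta| = 1 + (2 * beta + 1) * (alpha + 1).
Proof. by rewrite card_option card_prod !card_ord. Qed.

(* Main.v *)
(* With at most beta new edges there are at most 2 beta endpoints, so one of the
   2 beta + 1 legs meets no new edge and hangs off v in H. There are at most
   alpha unoccupied vertices, so this leg of alpha + 1 vertices always carries a
   robot. In one move each robot crosses at most one edge and no two robots swap
   along an edge, so the robot farthest from v on this leg stays the same
   forever; hence it cannot be exchanged with another robot. *)
Require Import Defs.
From HB Require Import structures.
From mathcomp Require Import all_boot perm.
From mathcomp Require Import zify.

Set Implicit Arguments.
Unset Strict Implicit.
Unset Printing Implicit Defensive.

(** * One move, seen robot by robot *)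

Lemma codom_position (p : nat) (W : finType) (S : configuration p W) i :
  S i \in codom S.
Proof. exact: codom_f. Qed.

Lemma position_injective (p : nat) (W : finType) (S : configuration p W) :
  injective S.
Proof. exact/injectiveP/position_inj. Qed.

(** The last vertex of the path is free, so a robot on the path has an index strictly below [size s]
    and really advances. *)
Lemma simple_path_step (p : nat) (W : finType) (S T : configuration p W)
    (u0 : W) (s : seq W) i :
  last u0 s \notin codom S ->
  (forall i j, j < size s ->
     S i = nth u0 (u0 :: s) j -> T i = nth u0 (u0 :: s) j.+1) ->
  S i \in u0 :: s ->
  exists2 j, j < size s &
    S i = nth u0 (u0 :: s) j /\ T i = nth u0 (u0 :: s) j.+1.
Proof.
move=> free step iP.
have Si : S i = nth u0 (u0 :: s) (index (S i) (u0 :: s)) by rewrite nth_index.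
have lt_s : index (S i) (u0 :: s) < size s.
  have : index (S i) (u0 :: s) <= size s by rewrite -ltnS index_mem.
  rewrite leq_eqVlt => /orP[/eqP eq_s|//]; case/negP: free.
  by rewrite (last_nth u0) -eq_s -Si codom_position.
by exists (index (S i) (u0 :: s)) => //; split=> //; apply: step.
Qed.

Lemma valid_move_adj (p : nat) (W : finType) (H : sgraph W)
    (S T : configuration p W) i :
  valid_move H S T -> T i = S i \/ H (S i) (T i).
Proof.
case=> [[u0 [s [/andP[adj_s _] free _ fixed step]]]|
        [c [/and3P[_ cyc _] _ _ fixed step]]|->].
- have [iP|/fixed] := boolP (S i \in u0 :: s); last by left.
  have [j lt_s [-> ->]] := simple_path_step free step iP.
  by right; apply: (pathP u0 adj_s).
- have [ic|/fixed] := boolP (S i \in c); last by left.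
  by right; rewrite step //; apply: next_cycle.
- by left.
Qed.

(** Rotated to start at [x], the cycle reads x, y, z, ... with z distinct from x. Length at least 3
    is what rules out a swap by rotation. *)
Lemma next_next_neq (W : eqType) (c : seq W) x :
  2 < size c -> uniq c -> x \in c -> next c (next c x) != x.
Proof.
move=> c_gt2 Uc /rot_to[k c' rot_c].
have Urot : uniq (x :: c') by rewrite -rot_c rot_uniq.
rewrite -!(next_rot k Uc) rot_c.
have : 2 < size (x :: c') by rewrite -rot_c size_rot.
case: c' Urot {rot_c} => [|y [|z c']] //= /and3P[].
rewrite !inE !negb_or => /and3P[xNy xNz _] _ _ _.
by rewrite eqxx [y == x]eq_sym (negPf xNy) eqxx eq_sym.
Qed.

(** On a path with indices j and k, a swap would force both k = j + 1 and j = k + 1; on a cycle, two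
    steps would lead back to the start. *)
Lemma valid_move_noswap (p : nat) (W : finType) (H : sgraph W)
    (S T : configuration p W) i r :
  valid_move H S T -> T i = S r -> T r = S i -> i = r.
Proof.
move=> mv Ti Tr; apply/eqP/contraT => iNr.
have SiNr : S r != S i.
  by apply: contraNneq iNr => /position_injective->.
case: mv => [[u0 [s [/andP[_ Us] free _ fixed step]]]|
             [c [/and3P[c3 _ Uc] _ _ fixed step]]|TS].
- have [iP|/fixed TiS] := boolP (S i \in u0 :: s); last first.
    by rewrite -TiS Ti eqxx in SiNr.
  have [j lt_s [Si Ti']] := simple_path_step free step iP.
  have rP : S r \in u0 :: s by rewrite -Ti Ti' mem_nth //= ltnS.
  have [k lt_ks [Sr Tr']] := simple_path_step free step rP.
  have jk : k = j.+1.
    apply/eqP; rewrite -(nth_uniq u0 _ _ Us) /= ?ltnS ?(ltnW lt_ks) //.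
    by rewrite -[nth u0 (u0 :: s) k]Sr -Ti Ti'.
  have : k.+1 = j.
    apply/eqP; rewrite -(nth_uniq u0 _ _ Us) /= ?ltnS ?(ltnW lt_s) //.
    by rewrite -[nth u0 (u0 :: s) j]Si -Tr Tr'.
  lia.
- have [ic|/fixed TiS] := boolP (S i \in c); last first.
    by rewrite -TiS Ti eqxx in SiNr.
  have Ti' := step i ic.
  have rc : S r \in c by rewrite -Ti Ti' mem_next.
  by have := next_next_neq c3 Uc ic; rewrite -Ti' Ti -(step r rc) Tr eqxx.
- by rewrite -Ti TS eqxx in SiNr.
Qed.

(** * The deepest robot as an invariant, for an abstract depth [d] *)

Definition deepest (p : nat) (W : finType) (d : W -> nat)
    (S : configuration p W) (r : 'I_p) : Prop :=
  forall i, i != r -> d (S i) < d (S r).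

(** If [i] overtakes [r], then since depths change by at most one, [i] climbs from some level m to m
    + 1 while [r] drops from m + 1 to m. By [d_edge] a single edge joins these levels, so the two
    robots swap along it. *)
Lemma deepest_valid_move (p : nat) (W : finType) (H : sgraph W) (d : W -> nat)
    (d_adj : forall x y, H x y -> d x <= (d y).+1)
    (d_edge : forall x y x' y', H x y -> H x' y' -> d x' = d x ->
       d y = (d x).+1 -> d y' = (d x).+1 -> x' = x /\ y' = y)
    (d_inj : forall x y, 0 < d x -> d x = d y -> x = y)
    (d_pos : forall S : configuration p W, exists i, 0 < d (S i))
    (S T : configuration p W) r :
  valid_move H S T -> deepest d S r -> deepest d T r.
Proof.
move=> mv deepS.
have lip i : d (T i) <= (d (S i)).+1 /\ d (S i) <= (d (T i)).+1.
  case: (valid_move_adj i mv) => [->|adjST]; first by lia.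
  by split; apply: d_adj; rewrite // adj_sym.
(* Level 0 may hold many robots, so the comparison is made at positive depth only; [d_pos] then
   places [r] itself at positive depth. *)
suff pos_lt i : i != r -> 0 < d (T i) -> d (T i) < d (T r).
  have Tr_gt0 : 0 < d (T r).
    have [i Ti_gt0] := d_pos T.
    by have [<-//|iNr] := eqVneq i r; have := pos_lt i iNr Ti_gt0; lia.
  by move=> i iNr; case: (posnP (d (T i))) => [->//|]; apply: pos_lt.
move=> iNr Ti_gt0; rewrite ltnNge; apply/negP => le_ri.
(* No tie is possible: a positive level is a single vertex. *)
have lt_ri : d (T r) < d (T i).
  rewrite ltn_neqAle le_ri andbT; apply: contraNneq iNr => eq_ri.
  by apply/eqP/(@position_injective _ _ T)/d_inj.
have [[[Ti_le _] [_ Sr_le]] Si_lt] := (lip i, lip r, deepS i iNr).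
have adj_i : H (S i) (T i).
  by case: (valid_move_adj i mv) => // TiS; move: (congr1 d TiS); lia.
have adj_r : H (T r) (S r).
  case: (valid_move_adj r mv) => [TrS|]; last by rewrite adj_sym.
  by move: (congr1 d TrS); lia.
have [Tr_eq Sr_eq] : T r = S i /\ S r = T i.
  by apply: d_edge adj_i adj_r _ _ _; lia.
by rewrite (valid_move_noswap mv (esym Sr_eq) Tr_eq) eqxx in iNr.
Qed.

Lemma deepest_reachable (p : nat) (W : finType) (H : sgraph W) (d : W -> nat)
    (d_valid : forall (S T : configuration p W) r,
       valid_move H S T -> deepest d S r -> deepest d T r)
    (S T : configuration p W) r :
  reachable H S T -> deepest d S r -> deepest d T r.
Proof.
move=> [t [C [<- <- mv]]] deep0.
elim: t mv => [//|t IHt] mv; apply: (d_valid _ _ _ (mv t _)) => //.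
by apply: IHt => k lt_kt; apply: mv; apply: ltnW.
Qed.

Lemma deepest_exists (p : nat) (W : finType) (d : W -> nat)
    (d_inj : forall x y, 0 < d x -> d x = d y -> x = y)
    (S : configuration p W) :
  (exists i, 0 < d (S i)) -> exists r, deepest d S r.
Proof.
move=> [i0 Si0_gt0].
case: (@arg_maxnP _ i0 xpredT (fun i => d (S i)) isT) => r _ geq_r.
have max_r i : d (S i) <= d (S r) by apply: geq_r.
exists r => i iNr; rewrite ltn_neqAle max_r andbT.
apply: contraNneq iNr => eq_ir; apply/eqP/(@position_injective _ _ S)/d_inj => //.
by rewrite eq_ir; apply: leq_trans Si0_gt0 (max_r i0).
Qed.

Lemma permuted_configuration_inj (p : nat) (W : finType)
    (S : configuration p W) (s : {perm 'I_p}) :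
  injectiveb [ffun i => S (s i)].
Proof.
by apply/injectiveP => i j; rewrite !ffunE => /position_injective/perm_inj.
Qed.

(** Exchanging [r] with any other robot gives a configuration where [r] is no longer deepest. *)
Lemma deepest_not_universally_solvable (p : nat) (W : finType) (H : sgraph W)
    (d : W -> nat)
    (d_valid : forall (S T : configuration p W) r,
       valid_move H S T -> deepest d S r -> deepest d T r)
    (S : configuration p W) r :
  1 < p -> deepest d S r -> ~ universally_solvable p H.
Proof.
move=> p_gt1 deepS solv.
have [j jNr] : exists j, j != r.
  have [/eqP r0|rN0] := boolP (r == 0 :> nat).
    by exists (Ordinal p_gt1); rewrite -val_eqE /= r0.
  by exists (Ordinal (ltnW p_gt1)); rewrite -val_eqE eq_sym.
pose T := Configuration (permuted_configuration_inj S (tperm j r)).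
have := deepest_reachable d_valid (solv S T) deepS jNr.
rewrite !ffunE tpermL tpermR => /ltnW.
by rewrite leqNgt deepS.
Qed.

(** * A leg avoided by the new edges, and its depth function *)

Lemma card_edge (W : finType) (H : sgraph W) (E : {set W}) :
  E \in edges H -> #|E| <= 2.
Proof. by case/imsetP=> u _ ->; rewrite cards2; case: eqP. Qed.

Lemma untouched_leg (alpha beta : nat) (N : finType)
    (H : sgraph (Zvertex alpha beta + N)%type) :
  #|new_edges (Zgraph alpha beta) H| <= beta ->
  exists l : 'I_(2 * beta + 1), forall j : 'I_(alpha + 1),
    inl (Some (l, j)) \notin cover (new_edges (Zgraph alpha beta) H).
Proof.
set NE := new_edges _ H => le_beta.
have cover_le : #|cover NE| <= 2 * beta.
  apply: leq_trans (leq_card_cover _) _.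
  apply: (@leq_trans (\sum_(E in NE) 2)); last first.
    by rewrite sum_nat_const mulnC leq_mul2l.
  by apply: leq_sum => E /setDP[/card_edge].
(* The boolean form allows an argument by contradiction: one touched vertex chosen on each leg would
   inject the 2 beta + 1 legs into a cover of at most 2 beta vertices. *)
suff: [exists l : 'I_(2 * beta + 1),
    [forall j : 'I_(alpha + 1), inl (Some (l, j)) \notin cover NE]].
  by case/existsP=> l /forallP; exists l.
apply: contraT => /existsPn touched.
have /fin_all_exists[f fP] l : exists j : 'I_(alpha + 1),
    inl (Some (l, j)) \in cover NE.
  by have /forallPn[j] := touched l; rewrite negbK; exists j.
pose g l : (Zvertex alpha beta + N)%type := inl (Some (l, f l)).
have g_inj : injective g by move=> l l' [].
have : #|[set g l | l in 'I_(2 * beta + 1)]| <= #|cover NE|.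
  by apply/subset_leq_card/subsetP => _ /imsetP[l _ ->]; apply: fP.
by rewrite card_imset // card_ord; lia.
Qed.

(** Everything off leg [l], centre included, collapses to level 0, so motion there is ignored; on
    the leg, depth is the distance to the centre in Z. *)
Definition leg_depth (alpha beta : nat) (N : finType) (l : 'I_(2 * beta + 1))
    (x : Zvertex alpha beta + N) : nat :=
  if x is inl (Some (i, j)) then if i == l then j.+1 else 0 else 0.

Section LegDepth.

Variables (alpha beta : nat) (N : finType) (l : 'I_(2 * beta + 1)).
Local Notation W := (Zvertex alpha beta + N)%type.
Local Notation d := (@leg_depth alpha beta N l).

Lemma leg_depth_gt0 (x : W) :
  0 < d x -> exists2 j, x = inl (Some (l, j)) & d x = j.+1.
Proof.
by case: x => [[[i j]|]|//] //=; case: eqP => // -> _; exists j.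
Qed.

Lemma leg_depth_inj (x y : W) : 0 < d x -> d x = d y -> x = y.
Proof.
move=> dx_gt0 eq_d; have dy_gt0 : 0 < d y by rewrite -eq_d.
have [j x_eq dx] := leg_depth_gt0 dx_gt0.
have [k y_eq dy] := leg_depth_gt0 dy_gt0.
rewrite x_eq y_eq; congr (inl (Some (_, _))); apply/ord_inj/succn_inj.
by rewrite -dx -dy.
Qed.

(** Pigeonhole: with n robots, off the leg there are n + #|N| - (alpha + 1) < n vertices. *)
Lemma leg_depth_occupied (S : configuration (1 + (2 * beta + 1) * (alpha + 1)) W) :
  #|N| <= alpha -> exists i, 0 < d (S i).
Proof.
move=> le_N; apply/existsP; apply: contraT => /existsPn empty.
pose leg : {set W} := [set inl (Some (l, j)) | j in 'I_(alpha + 1)].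
have card_leg : #|leg| = alpha + 1.
  by rewrite card_imset ?card_ord // => j j' [].
have : #|[set S i | i in setT]| <= #|~: leg|.
  apply/subset_leq_card/subsetP => _ /imsetP[i _ ->].
  rewrite inE; apply: contra (empty i) => /imsetP[j _ ->].
  by rewrite /= eqxx.
have := cardsC leg.
rewrite card_imset; last exact: position_injective.
rewrite cardsT card_ord card_leg card_sum card_Zvertex; lia.
Qed.

Variable H : sgraph W.
Hypothesis l_untouched : forall j : 'I_(alpha + 1),
  inl (Some (l, j)) \notin cover (new_edges (Zgraph alpha beta) H).

Lemma untouched_leg_adj (x y : W) : H x y -> 0 < d y ->
  exists u w, [/\ x = inl u, y = inl w & Zgraph alpha beta u w].
Proof.
move=> adj_xy /leg_depth_gt0[j y_def _].
have xyE : [set x; y] \in edges H by apply/imsetP; exists (x, y); rewrite ?inE.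
have : [set x; y] \notin new_edges (Zgraph alpha beta) H.
  apply: contra (l_untouched j) => xyN.
  by apply/bigcupP; exists [set x; y] => //; rewrite y_def set22.
rewrite inE xyE andbT negbK => /imsetP[E /imsetP[[u w]]].
rewrite inE /= => adj_uw ->.
have adj_wu : Zgraph alpha beta w u by rewrite adj_sym.
rewrite imsetU1 imset_set1 => xy_uw.
have xNy : x != y by apply: contraTneq adj_xy => ->; rewrite adj_irr.
(* Equal unordered pairs match in two ways; the two other cases would make [x] and [y] equal. *)
have := set21 x y; have := set22 x y; rewrite xy_uw !inE.
move=> /orP[]/eqP y_eq /orP[]/eqP x_eq.
- by rewrite x_eq y_eq eqxx in xNy.
- by exists w, u.
- by exists u, w.
- by rewrite x_eq y_eq eqxx in xNy.
Qed.

Lemma leg_depth_adj (x y : W) : H x y -> d y <= (d x).+1.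
Proof.
move=> adj_xy; case: (posnP (d y)) => [->//|dy_gt0].
have [u [w [-> -> ]]] := untouched_leg_adj adj_xy dy_gt0.
case: u w => [[i j]|] [[i' j']|] //=; last by case: ifP => // _ /eqP->.
by case/andP=> /eqP <-; case: ifP => // _ ; lia.
Qed.

(** The first vertex of the leg has only edges of Z, and among these only the one to the centre
    leaves the leg. *)
Lemma leg_depth_pred (x y : W) : H x y -> d y = 1 -> d x = 0 -> x = inl None.
Proof.
move=> adj_xy dy dx.
have [u [w [x_eq y_eq]]] := untouched_leg_adj adj_xy (eq_leq (esym dy)).
move: dx dy; rewrite {}x_eq {}y_eq.
case: u w => [[i j]|] [[i' j']|] //=; case: eqP => // iNl _.
by case: eqP => // -> _ /andP[/eqP].
Qed.

(** Depth determines vertices at positive levels. It does not at level 0, where [leg_depth_pred]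
    identifies the lower end as the centre. *)
Lemma leg_depth_edge (x y x' y' : W) : H x y -> H x' y' -> d x' = d x ->
  d y = (d x).+1 -> d y' = (d x).+1 -> x' = x /\ y' = y.
Proof.
move=> adj_xy adj_xy' eq_x dy dy'; split; last first.
  by apply: leg_depth_inj; rewrite dy' ?dy.
case: (posnP (d x)) => [dx0|dx_gt0]; last by apply: leg_depth_inj; rewrite eq_x.
rewrite dx0 in eq_x dy dy'.
by rewrite (leg_depth_pred adj_xy dy dx0) (leg_depth_pred adj_xy' dy' eq_x).
Qed.

End LegDepth.

(** * An initial configuration, with all new vertices empty, and the conclusion *)

Lemma Zvertex_configuration (alpha beta : nat) (N : finType) :
  inhabited (configuration (1 + (2 * beta + 1) * (alpha + 1))
    (Zvertex alpha beta + N)%type).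
Proof.
pose f (i : 'I_(1 + (2 * beta + 1) * (alpha + 1))) :
    (Zvertex alpha beta + N)%type :=
  inl (enum_val (cast_ord (esym (card_Zvertex alpha beta)) i)).
have f_inj : injectiveb (finfun f).
  by apply/injectiveP => i j; rewrite !ffunE => -[] /enum_val_inj/cast_ord_inj.
by constructor; exact: Configuration f_inj.
Qed.

Theorem theorem29 (alpha beta : nat) :
  ~ exists (N : finType) (H : sgraph (Zvertex alpha beta + N)%type),
      [/\ #|N| <= alpha,
          extends (Zgraph alpha beta) H,
          #|new_edges (Zgraph alpha beta) H| <= beta
        & universally_solvable (1 + (2 * beta + 1) * (alpha + 1)) H].
Proof.
move=> [N [H [le_N _ /untouched_leg[l free_l]]]].
have occupied S := leg_depth_occupied l S le_N.
have [S] := Zvertex_configuration alpha beta N.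
have [r deepS] := deepest_exists (@leg_depth_inj _ _ _ l) (occupied S).
apply: deepest_not_universally_solvable deepS; last by lia.
apply: deepest_valid_move occupied.
- by move=> x y adj_xy; apply: (leg_depth_adj free_l); rewrite adj_sym.
- exact: leg_depth_edge.
- exact: leg_depth_inj.
Qed.
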